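(* Let $R=[a,b]\times[c,d]$, let $\Delta$ be a net on $R$, $m,n\in\mathbb{N}$ and $0\le q<1$. The multi-valued mapping $\mathcal{T}^\Delta_{m,n}:\mathcal{C}(R)\rightrightarrows\mathcal{C}(R)$ defined by $$\mathcal{T}^\Delta_{m,n}(f)=\{f^\alpha_{\Delta,B_{m,n}}:\alpha\in\mathcal{C}(R),\ \|\alpha\|_\infty\le q<1\}$$ is Lipschitz.
   Context: Here $a<b$, $c<d$, and $\mathcal{C}(R)$ is the Banach space of continuous real functions on $R$ with supremum norm $\|\cdot\|_\infty$. Bernstein operator: for $m,n\in\mathbb{N}$ and $f\in\mathcal{C}(R)$, $$B_{m,n}(f)(x,y)=\frac{1}{(b-a)^m(d-c)^n}\sum_{i=0}^m\sum_{j=0}^n f\Big(a+\tfrac{i(b-a)}{m},c+\tfrac{j(d-c)}{n}\Big)\binom{m}{i}\binom{n}{j}(x-a)^i(b-x)^{m-i}(y-c)^j(d-y)^{n-j}.$$ Net: $\Delta=\{(x_i,y_j):0\le i\le N,\ 0\le j\le M\}$ with $a=x_0<x_1<\dots<x_N=b$ and $c=y_0<y_1<\dots<y_M=d$, $N,M\ge2$. Put $I=[a,b]$, $J=[c,d]$, $I_i=[x_{i-1},x_i]$, $J_j=[y_{j-1},y_j]$, $R_{ij}=I_i\times J_j$. For $1\le i\le N$, $u_i:I\to I_i$ is a contraction that is a homeomorphism onto $I_i$, with $u_i(x_0)=x_{i-1}$, $u_i(x_N)=x_i$ if $i$ is odd and $u_i(x_0)=x_i$, $u_i(x_N)=x_{i-1}$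 if $i$ is even. For $1\le j\le M$, $v_j:J\to J_j$ is a contraction that is a homeomorphism onto $J_j$, with $v_j(y_0)=y_{j-1}$, $v_j(y_M)=y_j$ if $j$ is odd and $v_j(y_0)=y_j$, $v_j(y_M)=y_{j-1}$ if $j$ is even. The maps $u_i,v_j$ are fixed for the net. Put $Q_{ij}(x,y)=(u_i^{-1}(x),v_j^{-1}(y))$ for $(x,y)\in R_{ij}$. $\alpha$-fractal function: for $f\in\mathcal{C}(R)$ and $\alpha\in\mathcal{C}(R)$ with $\|\alpha\|_\infty<1$, $f^\alpha_{\Delta,B_{m,n}}$ is the unique function in $\mathcal{C}(R)$ satisfying, for all $\boldsymbol{x}\in R_{ij}$, $1\le i\le N$, $1\le j\le M$, $$f^\alpha_{\Delta,B_{m,n}}(\boldsymbol{x})=f(\boldsymbol{x})+\alpha(\boldsymbol{x})f^\alpha_{\Delta,B_{m,n}}(Q_{ij}(\boldsymbol{x}))-\alpha(\boldsymbol{x})B_{m,n}(f)(Q_{ij}(\boldsymbol{x})).$$ It is known that this function exists and is unique and that $f\mapsto f^\alpha_{\Delta,B_{m,n}}$ is bounded and linear. A multi-valued mapping $T:X\rightrightarrows Y$ between normed spaces, with $\mathrm{Dom}(T)=\{x\in X:T(x)\ne\emptyset\}$, is Lipschitz if there is a constant $l>0$ with $T(x_1)\subseteq T(x_2)+l\|x_1-x_2\|_X\,U_Y$ for all $x_1,x_2\in\mathrm{Dom}(T)$, where $U_Y=\{y\in Y:\|y\|_Y\le1\}$. *)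

(* Defs.v *)
From HB Require Import structures.
From mathcomp Require Import all_boot all_order all_algebra.
From mathcomp Require Import all_classical all_reals all_analysis.

Set Implicit Arguments.
Unset Strict Implicit.
Unset Printing Implicit Defensive.

Import Order.TTheory GRing.Theory Num.Theory.
Import numFieldNormedType.Exports.

Local Open Scope classical_set_scope.
Local Open Scope ring_scope.

Definition rect (R : realType) (a b c d : R) : set (R * R) :=
  `[a, b] `*` `[c, d].

(* A continuous function on the rectangle is represented by its extension by 0
   to the whole plane, so that Leibniz equality on [crect] is equality of
   functions on the rectangle. *)
Definition crect_pred (R : realType) (a b c d : R) : {pred R * R -> R} :=
  fun f => `[< {within rect a b c d, continuous f} /\
               forall p, ~ rect a b c d p -> f p = 0 >].

Record crect (R : realType) (a b c d : R) := CRect {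
  crect_val :> R * R -> R ;
  crect_valP : crect_val \in crect_pred a b c d }.

Section crect_normedModType.
Context (R : realType) (a b c d : R).
Local Notation K := (rect a b c d).
Local Notation C := (crect a b c d).

HB.instance Definition _ := [isSub for @crect_val R a b c d].
HB.instance Definition _ := [Choice of C by <:].

Lemma crect_submod_closed : submod_closed (crect_pred a b c d).
Proof.
split; first by apply/asboolP; split => // x; exact: cst_continuous.
move=> k f g /asboolP[fc f0] /asboolP[gc g0]; apply/asboolP; split.
  by move=> x; apply: cvgD; [apply: cvgZl_tmp; exact: fc | exact: gc].
move=> p Kp; rewrite -[LHS]/(k * f p + g p).
by rewrite f0// g0// mulr0 addr0.
Qed.

HB.instance Definition _ :=
  GRing.isSubmodClosed.Build R (R * R -> R) (crect_pred a b c d)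
    crect_submod_closed.
HB.instance Definition _ := [SubChoice_isSubLmodule of C by <:].

Lemma crect_continuous (f : C) : {within K, continuous f}.
Proof. by have /asboolP[] := crect_valP f. Qed.

Lemma crect_out (f : C) p : ~ K p -> f p = 0.
Proof. by have /asboolP[_] := crect_valP f; exact. Qed.

Lemma rect_compact : compact K.
Proof. by apply: compact_setX; exact: segment_compact. Qed.

Definition crect_norm (f : C) : R := sup [set `|f p| | p in K].

Lemma crect_norm_has_ubound (f : C) : has_ubound [set `|f p| | p in K].
Proof.
have /compact_bounded[M [_ MP]] :=
  continuous_compact (@crect_continuous f) rect_compact.
exists (M + 1) => _ [p Kp <-]; apply: (MP (M + 1)); first by rewrite ltrDl.
by exists p.
Qed.

Lemma crect_norm_ub (f : C) p : `|f p| <= crect_norm f.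
Proof.
have [Kp|Kp] := pselect (K p).
  by apply: ub_le_sup; [exact: crect_norm_has_ubound|exists p].
rewrite crect_out// normr0 /crect_norm.
set S := (X in sup X); have [S0|/set0P[_ [q Kq _]]] := eqVneq S set0.
  by rewrite S0 sup0.
apply: (le_trans (normr_ge0 (f q))); apply: ub_le_sup; last by exists q.
exact: crect_norm_has_ubound.
Qed.

Lemma crect_norm_le (f : C) M :
  0 <= M -> (forall p, K p -> `|f p| <= M) -> crect_norm f <= M.
Proof.
move=> M0 fM; rewrite /crect_norm; set S := (X in sup X).
have [S0|/set0P S0] := eqVneq S set0; first by rewrite S0 sup0.
by apply: ge_sup => // _ [p Kp <-]; exact: fM.
Qed.

Lemma crect_normD (f g : C) :
  crect_norm (f + g) <= crect_norm f + crect_norm g.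
Proof.
apply: crect_norm_le => [|p _].
  by rewrite addr_ge0// (le_trans (normr_ge0 _) (crect_norm_ub _ (a, c))).
rewrite -[_ p]/(f p + g p) (le_trans (ler_normD _ _))//.
by rewrite lerD// crect_norm_ub.
Qed.

Lemma crect_normZ (k : R) (f : C) :
  crect_norm (k *: f) = `|k| * crect_norm f.
Proof.
have le_normZ (l : R) (g : C) : crect_norm (l *: g) <= `|l| * crect_norm g.
  apply: crect_norm_le => [|p _].
    by rewrite mulr_ge0// (le_trans (normr_ge0 _) (crect_norm_ub _ (a, c))).
  by rewrite -[_ p]/(l * g p) normrM ler_wpM2l// crect_norm_ub.
apply/eqP; rewrite eq_le le_normZ /=.
have [->|k0] := eqVneq k 0.
  by rewrite normr0 mul0r (le_trans (normr_ge0 _) (crect_norm_ub _ (a, c))).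
rewrite -ler_pdivlMl ?normr_gt0// -normfV.
by rewrite -[in leLHS](scalerK k0 f).
Qed.

Lemma crect_norm0_eq0 (f : C) : crect_norm f = 0 -> f = 0.
Proof.
move=> f0; apply/val_inj/funext => p; apply/eqP.
by rewrite -normr_le0 -f0 crect_norm_ub.
Qed.

HB.instance Definition _ :=
  Lmodule_isNormed.Build R C crect_normD crect_normZ crect_norm0_eq0.

End crect_normedModType.

(* [i] is 1-based. *)
Definition subitv (R : realType) (x : nat -> R) (i : nat) : set R :=
  `[x i.-1, x i].

Definition homeo_onto (R : realType) (A B : set R) (h : R -> R) : Prop :=
  [/\ set_bij A B h, {within A, continuous h} &
      {within B, continuous (pinv A h)}].

Definition contraction_on (R : realType) (A : set R) (h : R -> R) : Prop :=
  exists2 k : R, 0 <= k < 1 & k.-lipschitz_A h.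

(* One coordinate of a net: knots a = x_0 < ... < x_N = b with N >= 2, together
   with the maps u_1, ..., u_N attached to them.  The values of [knot] and
   [branch] at other indices, and of [branch] outside [a, b], are irrelevant. *)
Record axis (R : realType) (a b : R) := Axis {
  nsub : nat ;
  knot : nat -> R ;
  branch : nat -> R -> R ;
  nsub_ge2 : (2 <= nsub)%N ;
  knot_first : knot 0 = a ;
  knot_last : knot nsub = b ;
  knot_lt : forall i, (i < nsub)%N -> knot i < knot i.+1 ;
  branch_contraction : forall i, (1 <= i <= nsub)%N ->
    contraction_on `[a, b] (branch i) ;
  branch_homeo : forall i, (1 <= i <= nsub)%N ->
    homeo_onto `[a, b] (subitv knot i) (branch i) ;
  branch_odd : forall i, (1 <= i <= nsub)%N -> odd i ->
    branch i (knot 0) = knot i.-1 /\ branch i (knot nsub) = knot i ;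
  branch_even : forall i, (1 <= i <= nsub)%N -> ~~ odd i ->
    branch i (knot 0) = knot i /\ branch i (knot nsub) = knot i.-1 }.

Record net (R : realType) (a b c d : R) := Net {
  xaxis : axis a b ;
  yaxis : axis c d }.

Section alpha_fractal.
Context (R : realType) (a b c d : R).
Local Notation C := (crect a b c d).

Definition bernstein (m n : nat) (f : R * R -> R) (z : R * R) : R :=
  ((b - a) ^+ m * (d - c) ^+ n)^-1 *
  \sum_(0 <= i < m.+1) \sum_(0 <= j < n.+1)
    f (a + i%:R * (b - a) / m%:R, c + j%:R * (d - c) / n%:R) *
    'C(m, i)%:R * 'C(n, j)%:R *
    (z.1 - a) ^+ i * (b - z.1) ^+ (m - i) *
    (z.2 - c) ^+ j * (d - z.2) ^+ (n - j).

Variable D : net a b c d.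

Definition cell (i j : nat) : set (R * R) :=
  subitv (knot (xaxis D)) i `*` subitv (knot (yaxis D)) j.

Definition cell_inv (i j : nat) (z : R * R) : R * R :=
  (pinv `[a, b] (branch (xaxis D) i) z.1,
   pinv `[c, d] (branch (yaxis D) j) z.2).

Definition fractal_equation (m n : nat) (f alpha h : C) : Prop :=
  forall i j, (1 <= i <= nsub (xaxis D))%N -> (1 <= j <= nsub (yaxis D))%N ->
  forall z, cell i j z ->
    h z = f z + alpha z * h (cell_inv i j z)
          - alpha z * bernstein m n f (cell_inv i j z).

Definition is_fractal (m n : nat) (f alpha h : C) : Prop :=
  unique (fractal_equation m n f alpha) h.

Definition fractal_map (m n : nat) (q : R) (f : C) : set C :=
  [set h | exists2 alpha : C, `|alpha| <= q & is_fractal m n f alpha h].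

End alpha_fractal.

Section multivalued.
Context (R : realType) (X Y : normedModType R).

Definition mdom (T : X -> set Y) : set X := [set x | T x !=set0].

Definition mlipschitz (T : X -> set Y) : Prop :=
  exists2 l : R, 0 < l & forall x1 x2, mdom T x1 -> mdom T x2 ->
    T x1 `<=` [set y + (l * `|x1 - x2|) *: e
                 | y in T x2 & e in [set e : Y | `|e| <= 1]].

End multivalued.

(* Main.v *)
(** The branch inverses of a net paste into a single continuous map [Phi] of
    the rectangle into itself, so that the cellwise self-referential equation is
    [h = f + alpha * (h \o Phi) - alpha * (B f \o Phi)].  Its right-hand side is
    a [q]-contraction in [h] when the norm of [alpha] is at most [q], hence it
    has a unique solution [f^alpha].  Since [B] is linear and does not increase
    sup norms, [`|f1^alpha - f2^alpha| <= (1 + q) / (1 - q) * `|f1 - f2|] for one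
    and the same [alpha], and this is the Lipschitz property. *)
From HB Require Import structures.
Require Import Defs.
From mathcomp Require Import all_boot all_order all_algebra.
From mathcomp Require Import all_classical all_reals all_analysis.
From mathcomp Require Import ring lra.

Set Implicit Arguments.
Unset Strict Implicit.
Unset Printing Implicit Defensive.

Import Order.TTheory GRing.Theory Num.Theory.
Import numFieldNormedType.Exports.

Local Open Scope classical_set_scope.
Local Open Scope ring_scope.

(** * Continuity on subsets and pasting along consecutive intervals *)

Lemma within_continuous_comp_homo (T U V : topologicalType) (A : set T)
    (B : set U) (f : T -> U) (g : U -> V) :
  (forall x, A x -> B (f x)) -> {within A, continuous f} ->
  {within B, continuous g} -> {within A, continuous (g \o f)}.
Proof.
move=> fAB /subspace_continuousP fc /subspace_continuousP gc.
apply/subspace_continuousP => x Ax W /(gc _ (fAB _ Ax)) gW.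
have fW : nbhs x [set y | A y -> B (f y) -> W (g (f y))] := fc x Ax _ gW.
apply: (@filterS _ (nbhs x) _ _ [set y | A y -> W (g (f y))] _ fW).
by move=> y fyW Ay; apply: fyW => //; exact: fAB.
Qed.

Lemma nondecreasing_upto (R : realType) (x : nat -> R) n :
  (forall i, (i < n)%N -> x i <= x i.+1) ->
  forall k l, (k <= l <= n)%N -> x k <= x l.
Proof.
move=> xS k; elim=> [|l IHl]; first by rewrite leqn0 => /andP[/eqP->].
rewrite leq_eqVlt => /andP[/predU1P[->//|kl] ln].
by apply: le_trans (IHl _) (xS _ _) => //; rewrite -ltnS kl ltnW.
Qed.

(** Induction on the number of pieces: two closed intervals meeting in one knot are pasted at each
    stage, the matching condition making the result well defined there. *)
Lemma glue_continuous (R : realType) (x : nat -> R) (phi : nat -> R -> R) n :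
  (forall i, (i <= n)%N -> x i <= x i.+1) ->
  (forall i, (i <= n)%N -> {within `[x i, x i.+1], continuous (phi i)}) ->
  (forall i, (i < n)%N -> phi i (x i.+1) = phi i.+1 (x i.+1)) ->
  exists2 g : R -> R, {within `[x 0, x n.+1], continuous g} &
    forall i y, (i <= n)%N -> x i <= y <= x i.+1 -> g y = phi i y.
Proof.
elim: n => [|n IHn] xS phic phiE.
  by exists (phi 0) => [|[]//]; exact: phic.
have [|||g gc gE] := IHn.
- by move=> i ni; apply: xS; rewrite leqW.
- by move=> i ni; apply: phic; rewrite leqW.
- by move=> i ni; apply: phiE; rewrite leqW.
have xle := @nondecreasing_upto _ x n.+2 xS.
pose h y := if y <= x n.+1 then g y else phi n.+1 y.
have hg y : y <= x n.+1 -> h y = g y by rewrite /h => ->.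
(* At [y = x n.+1] the test in [h] selects [g], which equals [phi n] there, and the matching
   condition turns this into [phi n.+1]. *)
have hphi y : x n.+1 <= y -> h y = phi n.+1 y.
  rewrite le_eqVlt /h => /predU1P[<-|]; last by case: leP.
  by rewrite lexx (gE n)// ?phiE// xle ?leqnSn ?lexx.
exists h => [|i y].
  have -> : `[x 0%N, x n.+2]%classic =
      `[x 0%N, x n.+1] `|` `[x n.+1, x n.+2]%classic.
    apply/seteqP; split => y /=; rewrite !in_itv/=.
      by move=> /andP[xy yx]; have [|/ltW] := leP y (x n.+1); [left|right];
        apply/andP.
    by move=> [|] /andP[xy yx]; apply/andP; split => //;
      [apply: le_trans yx _|apply: le_trans xy];
      apply: xle; rewrite ?leqnSn/=.
  apply: withinU_continuous; [exact: itv_closed|exact: itv_closed| |].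
    apply: subspace_eq_continuous gc => y.
    by rewrite inE/= in_itv/= => /andP[_ /hg].
  apply: subspace_eq_continuous (phic n.+1 _) => // y.
  by rewrite inE/= in_itv/= => /andP[/hphi].
rewrite leq_eqVlt => /predU1P[->|ni] /andP[xy yx]; first by rewrite hphi.
rewrite hg ?(gE i)// ?xy//.
by apply: le_trans yx _; apply: xle; rewrite ni leqnSn.
Qed.

(** * Completeness of the space of continuous functions on the rectangle *)

Lemma crect_ex (R : realType) (a b c d : R) (f : R * R -> R) :
  {within rect a b c d, continuous f} ->
  exists g : crect a b c d, forall z, rect a b c d z -> g z = f z.
Proof.
move=> fc.
have gP : f \_ (rect a b c d) \in crect_pred a b c d.
  apply/asboolP; split; last by move=> z Kz; rewrite /patch memNset.
  by apply: subspace_eq_continuous fc => z Kz; rewrite /from_subspace /patch Kz.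
by exists (CRect gP) => z Kz; rewrite /= /patch mem_set.
Qed.

(** Evaluation at a point is 1-Lipschitz for the sup norm, so pointwise limits exist; the Cauchy
    bound does not depend on the point, so convergence is uniform and the limit is continuous.
    Banach's fixed point theorem relies on this. *)
Lemma crect_complete (R : realType) (a b c d : R)
    (F : set_system (crect a b c d)) :
  ProperFilter F -> cauchy F -> cvg F.
Proof.
move=> FF /cauchy_ballP Fc.
have Fnear (e : R) : 0 < e ->
    \forall f \near F, \forall g \near F, `|f - g| < e.
  move=> e0; have /= [[A B] /= [FA FB] AB] := Fc e e0.
  apply: filterS FA => f Af; apply: filterS FB => g Bg.
  by have := AB (f, g) (conj Af Bg); rewrite /= -ball_normE.
pose l z := lim ((fun f : crect a b c d => f z) @ F).
have Fl z : (fun f : crect a b c d => f z) @ F --> l z.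
  apply: cauchy_cvg; apply: cauchy_exP => e /Fnear /filter_ex[f Ff].
  exists (f z); apply: filterS Ff => g; rewrite /= -ball_normE /=.
  exact: le_lt_trans (crect_norm_ub (f - g) z).
(* Let [g] tend to its limit in the Cauchy bound; the strict inequality becomes a weak one. *)
have lP (e : R) : 0 < e ->
    \forall f \near F, forall z, `|(f : crect a b c d) z - l z| <= e.
  move=> e0; apply: filterS (Fnear e e0) => f fg z.
  have : (fun g : crect a b c d => `|f z - g z|) @ F --> `|f z - l z|.
    by apply: cvg_norm; apply: cvgB; [exact: cvg_cst|exact: Fl].
  apply: (closed_cvg [set x : R | x <= e] (@closed_le R e)).
  apply: filterS fg => g /ltW; apply: le_trans.
  exact: (crect_norm_ub (f - g) z).
have lc : {within rect a b c d, continuous l}.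
  apply: (@uniform_limit_continuous_subspace _ _ _
    ((fun f : crect a b c d => f : R * R -> R) @ F)).
    have fc : \forall f \near F,
        {within rect a b c d, continuous (f : crect a b c d)}.
      by apply: nearW => f; exact: crect_continuous.
    exact: fc.
  move=> P /uniform_nbhs[E [/= + EP]].
  rewrite -entourage_ballE => -[e /= e0 eE].
  (* Halving [e] restores the strict inequality required by balls. *)
  have /lP : 0 < e / 2 by rewrite divr_gt0.
  apply: filterS => f fl; apply: EP => y _; apply: eE => /=.
  rewrite -ball_normE /= distrC; apply: le_lt_trans (fl y) _.
  by rewrite ltr_pdivrMr// ltr_pMr// ltr1n.
have [g gl] := crect_ex lc.
apply/cvg_ex; exists g; apply/cvgrPdist_le => e e0.
apply: filterS (lP e e0) => f fl; apply: crect_norm_le (ltW e0) _ => z Kz.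
by rewrite -[_ z]/(g z - f z) gl// distrC.
Qed.

HB.instance Definition _ (R : realType) (a b c d : R) :=
  Uniform_isComplete.Build (crect a b c d) (@crect_complete R a b c d).

(** * Folding an interval onto itself by the inverse branches *)

Lemma axis_cover (R : realType) (a b : R) (A : axis a b) x : x \in `[a, b] ->
  exists2 i, (1 <= i <= nsub A)%N & Defs.subitv (knot A) i x.
Proof.
suff cover n : (0 < n)%N -> knot A 0 <= x <= knot A n ->
    exists2 i, (1 <= i <= n)%N & Defs.subitv (knot A) i x.
  rewrite in_itv/= => xab; apply: cover.
    by rewrite (leq_trans _ (nsub_ge2 A)).
  by rewrite knot_first knot_last.
elim: n => // -[_ _ xA|n IHn _ /andP[x0 xn]].
  by exists 1%N => //; rewrite /Defs.subitv/= in_itv.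
have [xn1|/ltW xn1] := leP x (knot A n.+1).
  have [//||i /andP[i0 ni] xi] := IHn; first by rewrite x0.
  by exists i => //; rewrite i0 leqW.
by exists n.+2; rewrite ?leqnn// /Defs.subitv/= in_itv/= xn1 xn.
Qed.

Lemma subitv_sub (R : realType) (a b : R) (A : axis a b) i :
  (1 <= i <= nsub A)%N -> Defs.subitv (knot A) i `<=` `[a, b].
Proof.
move=> /andP[i0 iN] x; rewrite /Defs.subitv/= !in_itv/= => /andP[xi ix].
have le_knot := nondecreasing_upto (fun k kN => ltW (@knot_lt _ _ _ A k kN)).
have := le_knot 0%N i.-1; have := le_knot i (nsub A).
rewrite knot_first knot_last leqnn iN (leq_trans (leq_pred i))//=.
by move=> /(_ isT) ib /(_ isT) ai; rewrite (le_trans ai) ?(le_trans ix).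
Qed.

(* Consecutive branches run in opposite directions, so the two inverses agree at
   the knot shared by their intervals and paste into one continuous map. *)
Lemma axis_fold (R : realType) (a b : R) (A : axis a b) : a <= b ->
  exists g : R -> R, [/\ {within `[a, b], continuous g},
    forall x, x \in `[a, b] -> g x \in `[a, b] &
    forall i x, (1 <= i <= nsub A)%N -> Defs.subitv (knot A) i x ->
      g x = pinv `[a, b] (branch A i) x].
Proof.
move=> ab; have [n nE] : exists n, nsub A = n.+1.
  by exists (nsub A).-1; rewrite prednK// (leq_trans _ (nsub_ge2 A)).
have K0 := knot_first A; have KN := knot_last A.
have aab : a \in `[a, b]%classic by rewrite inE/= in_itv/= lexx ab.
have bab : b \in `[a, b]%classic by rewrite inE/= in_itv/= lexx ab.
have pinv_branch i x : (1 <= i <= nsub A)%N -> x \in `[a, b]%classic ->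
    pinv `[a, b] (branch A i) (branch A i x) = x.
  by move=> /(branch_homeo)[[_ inj _] _ _] xab; rewrite pinvKV.
(* Pieces are numbered from 0 and branches from 1, so piece [i] inverts branch [i.+1]. *)
have [|||g gc gE] := @glue_continuous _ (knot A)
    (fun i => pinv `[a, b]%classic (branch A i.+1)) n.
- by move=> i ni; apply/ltW/knot_lt; rewrite nE.
- move=> i ni; have iN : (1 <= i.+1 <= nsub A)%N by rewrite nE.
  by have [] := branch_homeo iN.
- move=> i ni.
  have i1 : (1 <= i.+1 <= nsub A)%N by rewrite nE/= ltnS ltnW.
  have i2 : (1 <= i.+2 <= nsub A)%N by rewrite nE/= ltnS.
  (* The common preimage [e] of the shared knot is [a] when [i] is odd and [b] when [i] is even. *)
  suff [e eab [e1 e2]] : exists2 e, e \in `[a, b]%classic &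
      branch A i.+1 e = knot A i.+1 /\ branch A i.+2 e = knot A i.+1.
    by rewrite -{1}e1 -e2 !pinv_branch.
  have [oi|oi] := boolP (odd i).
    exists a => //; split.
      by have [] := branch_even i1; rewrite /= ?oi// K0.
    by have [] := branch_odd i2; rewrite /= ?oi// K0.
  exists b => //; split.
    by have [] := branch_odd i1; rewrite /= ?oi// KN.
  by have [] := branch_even i2; rewrite /= ?oi// KN.
have gpinv i x : (i.+1 <= nsub A)%N -> Defs.subitv (knot A) i.+1 x ->
    g x = pinv `[a, b] (branch A i.+1) x.
  by rewrite nE /Defs.subitv/= in_itv => ni xi; exact: gE.
exists g; split.
- by move: gc; rewrite -nE K0 KN.
- move=> x /(axis_cover A)[[//|i] iN xi]; rewrite (gpinv i)//.
  have [[_ _ sur] _ _] := branch_homeo iN; have [y yab <-] := sur x xi.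
  by rewrite pinv_branch ?inE.
- by move=> [//|i] x iN; exact: gpinv.
Qed.

(** * The Bernstein operator: additivity, continuity and sup norm bound *)

Section bernstein_operator.
Context (R : realType) (a b c d : R) (m n : nat).

Lemma bernsteinB (f g : R * R -> R) z :
  bernstein a b c d m n (f \- g) z =
  bernstein a b c d m n f z - bernstein a b c d m n g z.
Proof.
rewrite /bernstein -mulrBr -sumrB; congr (_ * _); apply: eq_bigr => i _.
by rewrite -sumrB; apply: eq_bigr => j _; rewrite /= !mulrBl.
Qed.

Lemma continuous_bernstein (f : R * R -> R) :
  continuous (bernstein a b c d m n f).
Proof.
have cM (u v : R * R -> R) : continuous u -> continuous v ->
    continuous (fun z => u z * v z).
  by move=> uc vc z; apply: cvgM; [exact: uc|exact: vc].
have cX (u : R * R -> R) k : continuous u -> continuous (fun z => u z ^+ k).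
  move=> uc; elim: k => [|k IHk]; first by move=> z; exact: cvg_cst.
  rewrite (_ : (fun z => _) = fun z => u z * u z ^+ k); first exact: cM.
  by apply/funext => z; rewrite exprS.
have cB (u v : R * R -> R) : continuous u -> continuous v ->
    continuous (fun z => u z - v z).
  by move=> uc vc z; apply: cvgB; [exact: uc|exact: vc].
have c1 : continuous (fun z : R * R => z.1) by move=> z; exact: cvg_fst.
have c2 : continuous (fun z : R * R => z.2) by move=> z; exact: cvg_snd.
have cc (k : R) : continuous (fun _ : R * R => k) by move=> z; exact: cvg_cst.
apply: (cM) => //.
apply: (continuous_big (op := +%R)) => [|i _]; first exact: add_continuous.
apply: (continuous_big (op := +%R)) => [|j _]; first exact: add_continuous.
do 4 (apply: (cM); last by apply: (cX); apply: (cB)).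
exact: cc.
Qed.

(** On the rectangle the Bernstein weights are nonnegative and, after normalization, sum to 1, so
    the value is a weighted average of samples of [f]. Bounding [f] on the whole plane, as holds for
    extensions by 0, avoids locating the sample nodes. *)
Lemma bernstein_le (f : R * R -> R) M z : a < b -> c < d ->
  (forall p, `|f p| <= M) -> rect a b c d z ->
  `|bernstein a b c d m n f z| <= M.
Proof.
move=> ab cd fM [/=]; rewrite !in_itv/= => /andP[az zb] /andP[cz zd].
have E0 : 0 < (b - a) ^+ m * (d - c) ^+ n.
  by rewrite mulr_gt0// exprn_gt0// subr_gt0.
rewrite /bernstein normrM gtr0_norm ?invr_gt0// ler_pdivrMl//.
have -> : (b - a) ^+ m * (d - c) ^+ n = \sum_(0 <= i < m.+1)
    \sum_(0 <= j < n.+1) 'C(m, i)%:R * 'C(n, j)%:R *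
    (z.1 - a) ^+ i * (b - z.1) ^+ (m - i) *
    (z.2 - c) ^+ j * (d - z.2) ^+ (n - j).
  (* These splittings let the binomial theorem expand the normalizing factor into the sum of the
     weights. *)
  rewrite (_ : b - a = (b - z.1) + (z.1 - a)); last by ring.
  rewrite (_ : d - c = (d - z.2) + (z.2 - c)); last by ring.
  rewrite !exprDn !big_mkord mulr_suml; apply: eq_bigr => i _.
  rewrite mulr_sumr big_mkord; apply: eq_bigr => j _.
  rewrite -[_ *+ 'C(m, i)]mulr_natr -[_ *+ 'C(n, j)]mulr_natr; ring.
rewrite mulr_suml (le_trans (ler_norm_sum _ _ _))//; apply: ler_sum => i _.
rewrite mulr_suml (le_trans (ler_norm_sum _ _ _))//; apply: ler_sum => j _.
set w := (X in _ <= X * _); set p := (X in f X).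
have w0 : 0 <= w by rewrite /w !mulr_ge0 ?exprn_ge0 ?subr_ge0 ?ler0n.
apply: (@le_trans _ _ `|f p * w|); first by rewrite /w !mulrA.
by rewrite normrM (ger0_norm w0) mulrC ler_wpM2l.
Qed.

End bernstein_operator.

(** * The folding map of the rectangle *)

(** [Phi] is the product of the two axis folds. It coincides with [cell_inv] on every cell and the
    cells cover the rectangle, so the cellwise equations amount to a single one. *)
Lemma net_fold (R : realType) (a b c d : R) (D : net a b c d) :
    a <= b -> c <= d ->
  exists Phi : R * R -> R * R, [/\ {within rect a b c d, continuous Phi},
    forall z, rect a b c d z -> rect a b c d (Phi z) &
    forall m n f alpha h, fractal_equation D m n f alpha h <->
      forall z, rect a b c d z ->
        h z = f z + alpha z * h (Phi z) -
              alpha z * bernstein a b c d m n f (Phi z)].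
Proof.
move=> /(axis_fold (xaxis D))[u [uc uab uE]].
move=> /(axis_fold (yaxis D))[v [vc vcd vE]].
have cell_invE i j z : (1 <= i <= nsub (xaxis D))%N ->
    (1 <= j <= nsub (yaxis D))%N -> cell D i j z ->
    cell_inv D i j z = (u z.1, v z.2).
  by move=> iN jM [xi yj]; rewrite (uE i)// (vE j).
exists (fun z => (u z.1, v z.2)); split => [|z [xab ycd]|m n f alpha h].
- have uc2 : {within rect a b c d, continuous (u \o fst)}.
    apply: within_continuous_comp_homo uc => [z []//|].
    by apply: continuous_subspaceT => z; exact: cvg_fst.
  have vc2 : {within rect a b c d, continuous (v \o snd)}.
    apply: within_continuous_comp_homo vc => [z []//|].
    by apply: continuous_subspaceT => z; exact: cvg_snd.
  apply/subspace_continuousP => z Kz.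
  move/subspace_continuousP : uc2 => /(_ z Kz) uz.
  by move/subspace_continuousP : vc2 => /(_ z Kz) /(cvg_pair uz).
- by split; [exact: uab|exact: vcd].
- split=> H => [z [xab ycd]|i j iN jM z zij].
    have [i iN xi] := axis_cover (xaxis D) xab.
    have [j jM yj] := axis_cover (yaxis D) ycd.
    by rewrite (H i j)// (cell_invE i j).
  rewrite (cell_invE i j)//; apply: H.
  by case: zij => zi zj; split; [exact: subitv_sub zi|exact: subitv_sub zj].
Qed.

(** * Existence, uniqueness and stability of fractal functions *)

Section fractal_functions.
Context (R : realType) (a b c d : R) (D : net a b c d) (m n : nat).
Hypotheses (ab : a < b) (cd : c < d).
Variables (q : R) (q0 : 0 <= q) (q1 : q < 1).
Local Notation C := (crect a b c d).

(** Subtracting the two equations bounds the distance of the solutions in terms of itself with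
    factor [q < 1]; solving for it produces the constant. *)
Lemma fractal_equation_dist (alpha f1 f2 h1 h2 : C) : `|alpha| <= q ->
  fractal_equation D m n f1 alpha h1 -> fractal_equation D m n f2 alpha h2 ->
  `|h1 - h2| <= (1 + q) / (1 - q) * `|f1 - f2|.
Proof.
have [Phi [_ PhiK eqE]] := net_fold D (ltW ab) (ltW cd).
move=> alphaq /eqE h1E /eqE h2E.
suff : `|h1 - h2| <= `|f1 - f2| + q * (`|h1 - h2| + `|f1 - f2|).
  move=> H; rewrite mulrAC ler_pdivlMr ?subr_gt0//; lra.
apply: crect_norm_le => [|z Kz]; first by rewrite addr_ge0 ?mulr_ge0 ?addr_ge0.
have -> : (h1 - h2) z = (f1 - f2) z + alpha z * ((h1 - h2) (Phi z) -
    bernstein a b c d m n (f1 \- f2) (Phi z)).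
  rewrite bernsteinB -[(h1 - h2) z]/(h1 z - h2 z) h1E// h2E//.
  rewrite -[(f1 - f2) z]/(f1 z - f2 z).
  rewrite -[(h1 - h2) (Phi z)]/(h1 (Phi z) - h2 (Phi z)); ring.
apply: le_trans (ler_normD _ _) _; apply: lerD; first exact: crect_norm_ub.
rewrite normrM ler_pM//.
  by apply: le_trans alphaq; exact: crect_norm_ub.
apply: le_trans (ler_normB _ _) _; apply: lerD; first exact: crect_norm_ub.
apply: bernstein_le => //; last exact: PhiK.
by move=> p; exact: (crect_norm_ub (f1 - f2)).
Qed.

Lemma fractal_equation_unique (alpha f h1 h2 : C) : `|alpha| <= q ->
  fractal_equation D m n f alpha h1 -> fractal_equation D m n f alpha h2 ->
  h1 = h2.
Proof.
move=> alphaq h1E h2E; apply/eqP; rewrite -subr_eq0 -normr_le0.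
by have := fractal_equation_dist alphaq h1E h2E; rewrite subrr normr0 mulr0.
Qed.

Lemma fractal_equation_ex (alpha f : C) : `|alpha| <= q ->
  exists h, fractal_equation D m n f alpha h.
Proof.
have [Phi [Phic PhiK eqE]] := net_fold D (ltW ab) (ltW cd) => alphaq.
(* [T] is the right-hand side of the equation as an operator on [C]; choice selects its values
   because [crect_ex] only asserts existence. *)
have [T TE] : exists T : C -> C, forall h z, rect a b c d z ->
    T h z = f z + alpha z * h (Phi z) -
            alpha z * bernstein a b c d m n f (Phi z).
  suff /choice[T TE] : forall h : C, exists g : C, forall z, rect a b c d z ->
      g z = f z + alpha z * h (Phi z) -
            alpha z * bernstein a b c d m n f (Phi z) by exists T.
  move=> h; apply: crect_ex => z.
  have hPhi : {within rect a b c d, continuous (h \o Phi)}.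
    exact: within_continuous_comp_homo Phic (@crect_continuous _ _ _ _ _ h).
  have BPhi : {within rect a b c d,
      continuous (bernstein a b c d m n f \o Phi)}.
    apply: within_continuous_comp_homo PhiK Phic _.
    exact/continuous_subspaceT/continuous_bernstein.
  have alphac := @crect_continuous _ _ _ _ _ alpha.
  apply: cvgB; last by apply: cvgM; [exact: alphac|exact: BPhi].
  apply: cvgD; first exact: crect_continuous.
  by apply: cvgM; [exact: alphac|exact: hPhi].
have Tctr : is_contraction [fun of totalfun T].
  exists (NngNum q0); split => //= -[h1 h2] _ /=.
  apply: crect_norm_le => [|z Kz]; first exact: mulr_ge0.
  rewrite -[(T h1 - T h2) z]/(T h1 z - T h2 z) !TE//.
  (* The terms in [f] and its Bernstein polynomial do not involve [h] and cancel. *)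
  rewrite (_ : _ - _ = alpha z * (h1 - h2) (Phi z)); last first.
    by rewrite -[(h1 - h2) (Phi z)]/(h1 (Phi z) - h2 (Phi z)); ring.
  rewrite normrM ler_pM//; last exact: crect_norm_ub.
  by apply: le_trans alphaq; exact: crect_norm_ub.
have [|h _ hT] := banach_fixed_point Tctr closedT; first by exists 0.
by exists h; apply/eqE => z Kz; rewrite {1}hT TE.
Qed.

End fractal_functions.

(** * The Lipschitz property of the multi-valued map *)

Theorem theorem3p10 (R : realType) (a b c d : R) (hab : a < b) (hcd : c < d)
    (D : net a b c d) (m n : nat) (hm : (0 < m)%N) (hn : (0 < n)%N)
    (q : R) (hq0 : 0 <= q) (hq1 : q < 1) :
  mlipschitz (fractal_map D m n q).
Proof.
exists ((1 + q) / (1 - q)) => [|f1 f2 _ _ h1 [alpha alphaq [h1E _]]].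
  by rewrite divr_gt0// ?subr_gt0// ltr_pwDl.
(* The point of the second image to compare with [h1] is the fractal function of [f2] for the same
   [alpha]. *)
have [h2 h2E] := fractal_equation_ex D m n hab hcd hq0 hq1 f2 alphaq.
have := fractal_equation_dist hab hcd hq0 hq1 alphaq h1E h2E.
set r := _ * _ => h12; exists h2.
  exists alpha => //; split=> // h.
  exact: fractal_equation_unique alphaq h2E.
(* Normalizing [h1 - h2] by the bound [r] lands in the unit ball. If [r = 0], the convention
   [0^-1 = 0] makes this vector 0, and [h12] forces [h1 = h2]. *)
exists (r^-1 *: (h1 - h2)).
  rewrite /= normrZ normfV; have [r0|r0] := eqVneq r 0.
    by rewrite r0 normr0 invr0 mul0r.
  rewrite mulrC ler_pdivrMr ?normr_gt0// mul1r.
  exact: le_trans h12 (ler_norm _).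
have [r0|r0] := eqVneq r 0; last by rewrite scalerA divff// scale1r subrKC.
by move: h12; rewrite r0 normr_le0 subr_eq0 => /eqP ->; rewrite scale0r addr0.
Qed.
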